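(* Let $\lambda>0$, and let $\mathcal H_\lambda=\{(X(t),Y(t)):t\in[0,1]\}$ with $X,Y$ as in the context. Then $\mathcal H_\lambda$ is a hyperbolic curve, which satisfies, for all $t\in[0,1]$, $$\tanh(r_\lambda)^2\big(Y(t)-\tanh(r_\lambda)^{-2}\big)^2=\frac{1-\tanh(r_\lambda)^2}{\tanh(r_\lambda)^2}+(X(t)-1)^2 .$$ For $x\in[0,2]$, one has $X(t)=x$ if and only if $$t=\frac{r_\lambda-\operatorname{arcsinh}\big(\sinh(r_\lambda)x-\sinh(r_\lambda)\big)}{2r_\lambda},$$ and the ordinate of the point of $\mathcal H_\lambda$ with abscissa $x\in[0,2]$ is $$x-2\,\frac{\sinh\Big(\frac{r_\lambda}{2}+\frac12\operatorname{arcsinh}\big(\sinh(r_\lambda)(x-1)\big)\Big)^2}{\sinh(r_\lambda)^2}.$$ The area $\mathsf A(\mathcal H_\lambda)$ of the convex hull of $\mathcal H_\lambda$ and the affine length $\mathsf L_\lambda:=\mathsf L(\mathcal H_\lambda)$ satisfy $$\mathsf A(\mathcal H_\lambda)=r_\lambda\frac{\cosh(r_\lambda)}{\sinh(r_\lambda)^3}\Big(\frac{\sinh(2r_\lambda)}{2r_\lambda}-1\Big)=r_\lambda\,\lambda\,\frac{\cosh(r_\lambda)}{\sinh(r_\lambda)^3}=\frac{\lambda}{(\lambda+1)^3}\,\frac{\cosh(r_\lambda)^4}{r_\lambda^2},$$ $$\mathsf L_\lambda=2\prod_{k\ge0}2\Big(\frac{\cosh(r_\lambda/2^k)}{2(\cosh(r_\lambda/2^k)+1)^2}\Big)^{1/3}=\frac{2r_\lambda\cosh(r_\lambda)^{1/3}}{\sinh(r_\lambda)}=\frac{2\cosh(r_\lambda)^{4/3}}{\lambda+1}.$$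 Finally, for all $t\in[0,1]$, $\;Y''(t)X'(t)-X''(t)Y'(t)=\mathsf L_\lambda^3$.
   Context: The map $\Psi(r)=\frac{\sinh(2r)}{2r}-1$ (with $\Psi(0)=0$) is a continuous increasing bijection of $[0,+\infty)$ onto itself; $r_\lambda:=\Psi^{-1}(\lambda)$. For $\lambda>0$ and $t\in[0,1]$, $$X(t)=1+\frac{\sinh(r_\lambda(1-2t))}{\sinh(r_\lambda)},\qquad Y(t)=\frac{2\cosh(r_\lambda)}{\sinh(r_\lambda)^2}\sinh(r_\lambda(1-t))\sinh(r_\lambda t).$$ The affine length of a smooth planar curve $\mathcal C$ is $\mathsf L(\mathcal C)=\int_{\mathcal C}\kappa(s)^{1/3}\,ds$, where $\kappa$ is the curvature (taken non-negative for a convex curve) and $s$ the Euclidean arc length. *)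

(* Defs.v *)
From mathcomp Require Export all_boot all_order all_algebra.
From mathcomp Require Export all_classical all_reals all_analysis.

Set Implicit Arguments.
Unset Strict Implicit.
Unset Printing Implicit Defensive.

Export Order.TTheory GRing.Theory Num.Theory numFieldNormedType.Exports.

Local Open Scope classical_set_scope.
Local Open Scope ring_scope.

Section Hyperbolic.
Context {R : realType}.
Implicit Types x : R.

Definition sinh x : R := (expR x - expR (- x)) / 2.
Definition cosh x : R := (expR x + expR (- x)) / 2.
Definition tanh x : R := sinh x / cosh x.
Definition arcsinh x : R := ln (x + Num.sqrt (x ^+ 2 + 1)).

Definition Psi x : R := if x == 0 then 0 else sinh (2 * x) / (2 * x) - 1.

(* The inverse of Psi on [0, +oo[ ; the default value 0 is only used off the
   image of Psi. *)
Definition rl (lambda : R) : R := 'pinv_(fun=> 0) `[0, +oo[ Psi lambda.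

End Hyperbolic.

Section Curve.
Context {R : realType}.

(* The defining formulas are used on all of R, so that X, Y can be
   differentiated at the endpoints 0 and 1. *)
Definition X (lambda t : R) : R :=
  1 + sinh (rl lambda * (1 - 2 * t)) / sinh (rl lambda).

Definition Y (lambda t : R) : R :=
  2 * cosh (rl lambda) / sinh (rl lambda) ^+ 2
  * sinh (rl lambda * (1 - t)) * sinh (rl lambda * t).

Definition Hl (lambda : R) : set (R * R) :=
  [set (X lambda t, Y lambda t) | t in `[0, 1]].

End Curve.

Section PlaneGeometry.
Context {R : realType}.

(* A real conic a x^2 + b x y + c y^2 + d x + e y + f = 0 is a hyperbola when
   b^2 - 4 a c > 0 and it is nondegenerate; the expression required to be
   nonzero is 4 times the determinant of the symmetric matrix
   [a, b/2, d/2; b/2, c, e/2; d/2, e/2, f]. *)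
Definition is_hyperbola (S : set (R * R)) : Prop :=
  exists a b c d e f : R,
    [/\ 0 < b ^+ 2 - 4 * a * c,
        4 * a * c * f + b * d * e - a * e ^+ 2 - c * d ^+ 2 - f * b ^+ 2 != 0
      & S = [set p | a * p.1 ^+ 2 + b * p.1 * p.2 + c * p.2 ^+ 2
                     + d * p.1 + e * p.2 + f = 0]].

Definition is_arc (C : set (R * R)) : Prop :=
  exists g : R -> R * R,
    [/\ {within `[0, 1], continuous g},
        {in `[0, 1] &, injective g}
      & C = g @` `[0, 1]].

(* An arc of a hyperbola; being connected, it lies on a single branch. *)
Definition hyperbolic_curve (C : set (R * R)) : Prop :=
  is_arc C /\ exists2 S, is_hyperbola S & C `<=` S.

(* [smallest P A] is the intersection of all the sets satisfying P that
   contain A. *)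
Definition convex_hull (A : set (R * R)) : set (R * R) :=
  smallest (@convex_set R (R^o * R^o)%type) A.

Definition area (A : set (R * R)) : \bar R :=
  ((@lebesgue_measure R) \x (@lebesgue_measure R))%E A.

Definition speed (x y : R -> R) (t : R) : R :=
  Num.sqrt (derive1 x t ^+ 2 + derive1 y t ^+ 2).

Definition tangent1 (x y : R -> R) (t : R) : R := derive1 x t / speed x y t.
Definition tangent2 (x y : R -> R) (t : R) : R := derive1 y t / speed x y t.

(* |dT/ds|, with T the unit tangent and ds = speed dt. *)
Definition curvature (x y : R -> R) (t : R) : R :=
  speed (tangent1 x y) (tangent2 x y) t / speed x y t.

(* Integral of kappa^(1/3) ds over the curve parametrized by (x, y) on [a, b]
   (a regular, injective parametrization). *)
Definition affine_length (x y : R -> R) (a b : R) : R :=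
  \int[lebesgue_measure]_(t in `[a, b])
    (curvature x y t `^ 3^-1 * speed x y t).

End PlaneGeometry.

(* Main.v *)
Require Import Defs.
From mathcomp Require Import ring lra.

(** Put [u = r (1 - 2 t)].  The curve is then the branch of a hyperbola in its
    hyperbolic-angle parametrization:
    [X = 1 + sinh u / sinh r] and
    [Y = (cosh r / sinh r ^ 2) (cosh r - cosh u)] (lemma [Y_cosh]).
    The whole theorem is read off these two formulas.

    Eliminating [u] with [cosh ^ 2 - sinh ^ 2 = 1] gives the equation of the
    hyperbola; eliminating it with [cosh u = sqrt (1 + sinh u ^ 2)] presents
    the curve as the graph over [0, 2] of an explicit function, [height]
    (lemma [HlP]).  As [v |-> sqrt (1 + v ^ 2)] is convex, [height] is concave;
    it vanishes at 0 and 2, so the convex hull of the curve is the region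
    between the axis and the graph ([area_convex_hull_graph]), and its area is
    an integral with an elementary primitive ([integral_height]).

    The integrand [kappa ^ (1/3) ds] of the affine length is the cube root of
    [|x' y'' - x'' y'|] dt for every regular parametrization
    ([affine_integrandE]).  Here [x' y'' - x'' y'] is constant, because
    [cosh u ^ 2 - sinh u ^ 2] is ([X_Y_wronskian]), so the affine length is the
    cube root of that constant: this yields the value of the length and the
    last assertion together.  The infinite product telescopes by the formulas
    for [cosh (2 q)] and [sinh (2 q)], and converges because
    [2 ^ n sinh (r / 2 ^ n)] tends to [r].

    The three expressions of the area and of the length differ only by
    [lambda + 1 = sinh r * cosh r / r], which is the definition of [r]. *)

Set Implicit Arguments.
Unset Strict Implicit.
Unset Printing Implicit Defensive.

Local Open Scope classical_set_scope.
Local Open Scope ring_scope.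

(** * Hyperbolic functions *)

Section HyperbolicFunctions.
Context {R : realType}.
Implicit Types x y : R.

Lemma sinhN x : sinh (- x) = - sinh x.
Proof. by rewrite /sinh opprK; field. Qed.

Lemma coshN x : cosh (- x) = cosh x.
Proof. by rewrite /cosh opprK addrC. Qed.

Lemma sinh0 : sinh 0 = 0 :> R.
Proof. by rewrite /sinh oppr0 subrr mul0r. Qed.

Lemma sinhD x y : sinh (x + y) = sinh x * cosh y + cosh x * sinh y.
Proof. by rewrite /sinh /cosh opprD !expRD; field. Qed.

Lemma coshD x y : cosh (x + y) = cosh x * cosh y + sinh x * sinh y.
Proof. by rewrite /sinh /cosh opprD !expRD; field. Qed.

Lemma cosh_gt0 x : 0 < cosh x.
Proof. by rewrite /cosh divr_gt0// addr_gt0// expR_gt0. Qed.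

Lemma cosh2_sinh2 x : cosh x ^+ 2 = 1 + sinh x ^+ 2.
Proof.
have := expRxMexpNx_1 x; rewrite /cosh /sinh => e.
by rewrite -[X in _ = X + _]e; field.
Qed.

Lemma cosh_sqrt x : cosh x = Num.sqrt (1 + sinh x ^+ 2).
Proof. by rewrite -cosh2_sinh2 sqrtr_sqr ger0_norm// ltW// cosh_gt0. Qed.

Lemma sinh_gt0 x : 0 < x -> 0 < sinh x.
Proof. by move=> x0; rewrite /sinh divr_gt0// subr_gt0 ltr_expR; lra. Qed.

Lemma sinh2x x : sinh (2 * x) = 2 * (sinh x * cosh x).
Proof. by rewrite mulrDl mul1r sinhD; ring. Qed.

Lemma cosh2x x : cosh (2 * x) = 1 + 2 * sinh x ^+ 2.
Proof. by rewrite mulrDl mul1r coshD -!expr2 cosh2_sinh2; ring. Qed.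

Global Instance is_derive_sinh x : is_derive x 1 (@sinh R) (cosh x).
Proof.
rewrite /sinh; apply: is_derive_eq.
by rewrite /cosh /GRing.scale /=; field.
Qed.

Global Instance is_derive_cosh x : is_derive x 1 (@cosh R) (sinh x).
Proof.
rewrite /cosh; apply: is_derive_eq.
by rewrite /sinh /GRing.scale /=; field.
Qed.

Lemma continuous_sinh : continuous (@sinh R).
Proof. by move=> x; apply/differentiable_continuous/derivable1_diffP. Qed.

Lemma arcsinh_arg_gt0 x : 0 < x + Num.sqrt (x ^+ 2 + 1).
Proof.
have h : `|x| < Num.sqrt (x ^+ 2 + 1).
  by rewrite -sqrtr_sqr ltr_sqrt; nra.
by move: h; rewrite ltr_norml => /andP[h _]; lra.
Qed.

Lemma arcsinhK : cancel (@arcsinh R) sinh.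
Proof.
move=> x; have a0 := arcsinh_arg_gt0 x.
rewrite /sinh /arcsinh expRN lnK ?posrE//.
have s2 : Num.sqrt (x ^+ 2 + 1) ^+ 2 = x ^+ 2 + 1 by rewrite sqr_sqrtr//; nra.
set s := Num.sqrt _ in a0 s2 *.
have -> : (x + s)^-1 = s - x.
  by apply: (mulfI (lt0r_neq0 a0)); rewrite mulfV ?lt0r_neq0//; ring: s2.
by field.
Qed.

Lemma sinhK : cancel (@sinh R) arcsinh.
Proof.
move=> x; rewrite /arcsinh addrC (addrC _ 1) -cosh_sqrt.
have -> : cosh x + sinh x = expR x by rewrite /cosh /sinh; field.
exact: expRK.
Qed.

Lemma arcsinhN x : arcsinh (- x) = - arcsinh x.
Proof. by rewrite -[in LHS](arcsinhK x) -sinhN sinhK. Qed.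

Lemma ler_sinh : {mono (@sinh R) : x y / x <= y}.
Proof.
apply: le_mono => x y xy.
have [xy' yx'] : expR x < expR y /\ expR (- y) < expR (- x).
  by rewrite !ltr_expR; split; lra.
by rewrite /sinh; lra.
Qed.

(** The inverse function rule, with [cosh] expressed through [sinh]. *)
Global Instance is_derive_arcsinh x :
  is_derive x 1 (@arcsinh R) (Num.sqrt (1 + x ^+ 2))^-1.
Proof.
rewrite -{1 2}[x]arcsinhK -cosh_sqrt; apply: (@is_derive_inverse R sinh).
- by near=> z; exact: sinhK.
- by near=> z; exact: continuous_sinh.
- by rewrite gt_eqF// cosh_gt0.
Unshelve. all: by end_near. Qed.

Lemma is_derive_primitive_sqrt x :
  is_derive x 1 (fun v => (v * Num.sqrt (1 + v ^+ 2) + arcsinh v) / 2)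
    (Num.sqrt (1 + x ^+ 2)).
Proof.
have p0 : 0 < 1 + x ^+ 2 by nra.
have ds : is_derive x 1 (fun v => Num.sqrt (1 + v ^+ 2))
    ((2 * Num.sqrt (1 + x ^+ 2))^-1 * (2 * x)).
  apply: (@is_derive1_comp _ Num.sqrt (fun v => 1 + v ^+ 2)).
    exact: is_derive1_sqrt.
  by apply: is_derive_eq; rewrite /GRing.scale/=; ring.
apply: is_derive_eq.
have := sqr_sqrtr (ltW p0).
have : Num.sqrt (1 + x ^+ 2) != 0 by rewrite gt_eqF// sqrtr_gt0.
move: (Num.sqrt _) => s s0 s2; rewrite /GRing.scale/=.
by apply: (mulfI s0); rewrite -expr2 s2; field: s2; rewrite s0.
Qed.

End HyperbolicFunctions.

(** * The parameter [rl lambda] *)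

Section InversePsi.
Context {R : realType}.
Implicit Types r lambda : R.

(** The equation is that of a zero of [G y = sinh y - (1 + lambda) y] at
    [y = 2 r].  Near 0, [sinh y] is close to [y], so [G] is negative; far away,
    [sinh] grows more than linearly, so [G] is positive.  The intermediate
    value theorem is thus applied to [G] on a segment away from 0, where [Psi]
    is given by a separate clause. *)
Lemma Psi_eq lambda : 0 < lambda -> exists2 r, 0 < r & Psi r = lambda.
Proof.
move=> l0; pose G (y : R) := sinh y - (1 + lambda) * y.
have Gc : continuous G.
  by move=> y; apply/differentiable_continuous/derivable1_diffP.
pose a := lambda / (1 + 2 * lambda); pose b := 4 * (1 + lambda).
have a0 : 0 < a by rewrite divr_gt0//; lra.
have aE : a * (1 + 2 * lambda) = lambda by rewrite mulfVK// gt_eqF//; lra.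
have ab : a < b by rewrite /b; nra.
(* From [1 - a <= expR (- a)] one gets [sinh a <= a (2 - a) / (2 (1 - a))],
   which is less than [(1 + lambda) a] as soon as
   [(1 + 2 lambda) a < 2 lambda]. *)
have Ga : G a < 0.
  have e0 := expR_gt0 a; have eV := expRxMexpNx_1 a.
  have := expR_ge1Dx (- a); rewrite /G /sinh.
  have : a < 1 by nra.
  move: (expR a) (expR (- a)) e0 eV => e f e0 ef a1 fa.
  have : e * (1 - a) <= 1 by nra.
  nra.
(* [1 + b ^ 2 / 2 <= expR b] gives [sinh b > b ^ 2 / 4 = (1 + lambda) b]. *)
have Gb : 0 < G b.
  have b0 : 0 <= b by lra.
  have := expR_ge1Dxn 1 b0; have : expR (- b) < 1 by rewrite expR_lt1; lra.
  rewrite /G /sinh (_ : 1.+1`! = 2%N)// => h1 h2.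
  have {}h2 : 1 + b ^+ 2 / 2 <= expR b by [].
  by rewrite /b in h1 h2 *; nra.
have [||y] := @IVT R G a b 0 (ltW ab).
- by apply: continuous_subspaceT; exact: Gc.
- by rewrite ge_min le_max (ltW Ga) (ltW Gb) ?orbT.
rewrite in_itv/= => /andP[ay yb] Gy.
exists (y / 2); first by rewrite divr_gt0//; lra.
have y0 : 0 < y by lra.
rewrite /Psi gt_eqF ?divr_gt0// (_ : 2 * (y / 2) = y); last by field.
apply: (mulIf (lt0r_neq0 y0)); rewrite mulrBl divfK ?gt_eqF//.
by rewrite /G in Gy; lra.
Qed.

Lemma rl_spec lambda : 0 < lambda -> 0 < rl lambda /\ Psi (rl lambda) = lambda.
Proof.
move=> l0; have [r r0 rE] := Psi_eq l0.
have lP : (Psi @` `[0, +oo[) lambda.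
  by exists r => //=; rewrite in_itv/= andbT ltW.
have PsiK : Psi (rl lambda) = lambda by apply: pinvK; rewrite inE.
have : `[0, +oo[%classic (rl lambda).
  apply: (@surjpinv_image_sub _ _ _ `[0, +oo[%classic _ Psi
    (@subset_refl _ (Psi @` `[0, +oo[))).
  by exists lambda.
(* [rl lambda] is not 0, since [Psi 0 = 0] differs from [lambda]. *)
rewrite /= in_itv/= andbT le_eqVlt => /predU1P[r0'|//].
by move: PsiK l0; rewrite -r0' /Psi eqxx => <-; rewrite ltxx.
Qed.

End InversePsi.

(** * Affine length of a regular parametrized curve *)

Section AffineLength.
Context {R : realType}.

Lemma derive1_is_derive (f f' : R -> R) :
  (forall t : R, is_derive t 1 f (f' t)) -> derive1 f = f'.
Proof. by move=> df; apply/funext => t; rewrite derive1E derive_val. Qed.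

Context (x y x1 y1 x2 y2 : R -> R).
Context (dx : forall t : R, is_derive t 1 x (x1 t)).
Context (dy : forall t : R, is_derive t 1 y (y1 t)).
Context (dx1 : forall t : R, is_derive t 1 x1 (x2 t)).
Context (dy1 : forall t : R, is_derive t 1 y1 (y2 t)).
Context (regular : forall t, 0 < x1 t ^+ 2 + y1 t ^+ 2).

Let v (t : R) : R := Num.sqrt (x1 t ^+ 2 + y1 t ^+ 2).

Let v_gt0 t : 0 < v t.
Proof. by rewrite sqrtr_gt0. Qed.

Let v2 t : v t ^+ 2 = x1 t ^+ 2 + y1 t ^+ 2.
Proof. by rewrite sqr_sqrtr// ltW. Qed.

Let speedE : speed x y = v.
Proof.
apply/funext => t.
by rewrite /speed (derive1_is_derive dx) (derive1_is_derive dy).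
Qed.

Let dv (t : R) : is_derive t 1 v ((x1 t * x2 t + y1 t * y2 t) / v t).
Proof.
have -> : v = Num.sqrt \o (fun t => x1 t ^+ 2 + y1 t ^+ 2) by [].
have ds := is_derive1_sqrt (regular t).
apply: is_derive_eq; rewrite /GRing.scale /= -!/(v t); field.
by rewrite gt_eqF.
Qed.

(** Serves both coordinates of the unit tangent, [z] being [x1] or [y1]. *)
Let dtangent (z z1 : R -> R) (dz : forall t : R, is_derive t 1 z (z1 t))
    (t : R) :
  is_derive t 1 (fun s => z s / v s)
    ((z1 t * v t ^+ 2 - z t * (x1 t * x2 t + y1 t * y2 t)) / v t ^+ 3).
Proof.
have v0 : v t != 0 by rewrite gt_eqF.
have dV := is_deriveV v0 (dv t).
by apply: is_derive_eq; rewrite /GRing.scale /=; field.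
Qed.

(** With [D = x1 y2 - x2 y1], the derivative of the unit tangent is
    [(D / v ^ 3) (- y1, x1)], a vector of norm [|D| / v ^ 2]. *)
Lemma curvatureE t : curvature x y t = `|x1 t * y2 t - x2 t * y1 t| / v t ^+ 3.
Proof.
have v0 : v t != 0 by rewrite gt_eqF.
have T1 : tangent1 x y = fun s => x1 s / v s.
  by apply/funext => s; rewrite /tangent1 speedE (derive1_is_derive dx).
have T2 : tangent2 x y = fun s => y1 s / v s.
  by apply/funext => s; rewrite /tangent2 speedE (derive1_is_derive dy).
rewrite /curvature speedE T1 T2 {1}/speed !derive1E.
have [_ ->] := dtangent dx1 t; have [_ ->] := dtangent dy1 t.
rewrite [X in Num.sqrt X](_ : _ =
  ((x1 t * y2 t - x2 t * y1 t) / v t ^+ 2) ^+ 2).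
  rewrite sqrtr_sqr normrM normfV (ger0_norm (exprn_ge0 _ (ltW (v_gt0 t)))).
  by field.
by move: v0 (v2 t); move: (v t) => w w0 w2; field: w2.
Qed.

(** The powers of the speed cancel: this is why the affine length does not see
    area-preserving affine maps, under which the wronskian of the coordinates
    of the velocity is invariant up to sign. *)
Lemma affine_integrandE t :
  curvature x y t `^ 3^-1 * speed x y t
  = `|x1 t * y2 t - x2 t * y1 t| `^ 3^-1.
Proof.
have v0 := v_gt0 t; rewrite curvatureE speedE.
have vE : v t = (v t ^+ 3) `^ 3^-1.
  by rewrite -powR_mulrn ?ltW// -powRrM mulfV// powRr1 ?ltW.
have v3 : 0 < v t ^+ 3 by rewrite exprn_gt0.
rewrite [X in _ * X]vE -powRM ?divr_ge0 ?(ltW v3)//.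
by rewrite divfK// gt_eqF.
Qed.

End AffineLength.

(** * The curve: parametrization, graph and conic *)

Section HyperbolicCurve.
Context {R : realType}.
Context (lambda : R) (lambda_gt0 : 0 < lambda).
Local Notation r := (rl lambda).
Local Notation C := (cosh (rl lambda)).
Local Notation S := (sinh (rl lambda)).

Lemma rl_gt0 : 0 < r. Proof. by case: (rl_spec lambda_gt0). Qed.

Lemma sinh_rl_gt0 : 0 < S. Proof. exact/sinh_gt0/rl_gt0. Qed.

Lemma Psi_rl : sinh (2 * r) / (2 * r) - 1 = lambda.
Proof.
by case: (rl_spec lambda_gt0) => r0; rewrite /Psi gt_eqF.
Qed.

Lemma lambdaD1 : lambda + 1 = S * C / r.
Proof.
have r0 := rl_gt0.
by rewrite -[X in X + 1]Psi_rl sinh2x; field; rewrite gt_eqF.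
Qed.

(** The product-to-sum formula for [sinh a * sinh b], with [a + b = r]. *)
Lemma Y_cosh t : Y lambda t = C / S ^+ 2 * (C - cosh (r * (1 - 2 * t))).
Proof.
have S0 := sinh_rl_gt0; rewrite /Y.
have -> : cosh (r * (1 - 2 * t)) = cosh (r * (1 - t) + - (r * t)).
  by congr cosh; ring.
have E : C = cosh (r * (1 - t) + r * t) by congr cosh; ring.
rewrite [X in _ = _ * (X - _)]E.
move: (r * t) (r * (1 - t)) => a b; rewrite !coshD coshN sinhN.
by field; rewrite gt_eqF.
Qed.

Lemma hyperbola_eq t :
  tanh r ^+ 2 * (Y lambda t - tanh r ^- 2) ^+ 2
  = (1 - tanh r ^+ 2) / tanh r ^+ 2 + (X lambda t - 1) ^+ 2.
Proof.
have S0 := sinh_rl_gt0; have C0 := cosh_gt0 r.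
rewrite Y_cosh /X /tanh.
have CS := cosh2_sinh2 r; have cs := cosh2_sinh2 (r * (1 - 2 * t)).
by field: CS cs; rewrite !gt_eqF.
Qed.

(** Both directions say that [arcsinh (S x - S)] is the hyperbolic angle
    [r (1 - 2 t)]; this also makes [X lambda] injective. *)
Lemma X_arcsinh x t :
  X lambda t = x <-> t = (r - arcsinh (S * x - S)) / (2 * r).
Proof.
have r0 := rl_gt0; have S0 := sinh_rl_gt0; split=> [<-|->].
  have -> : S * X lambda t - S = sinh (r * (1 - 2 * t)).
    by rewrite /X; field; rewrite gt_eqF.
  by rewrite sinhK; field; rewrite gt_eqF.
rewrite /X.
have -> : r * (1 - 2 * ((r - arcsinh (S * x - S)) / (2 * r))) =
    arcsinh (S * x - S) by field; rewrite gt_eqF.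
by rewrite arcsinhK; field; rewrite gt_eqF.
Qed.

Lemma X_itv t : (X lambda t \in `[0, 2]) = (t \in `[0, 1]).
Proof.
have r0 := rl_gt0; have S0 := sinh_rl_gt0.
have XE : X lambda t = (S + sinh (r * (1 - 2 * t))) / S.
  by rewrite /X; field; rewrite gt_eqF.
rewrite !in_itv/= XE ler_pdivlMr// ler_pdivrMr// mul0r.
rewrite -lerBlDl sub0r -sinhN -lerBrDl (_ : 2 * S - S = S); last by ring.
rewrite !ler_sinh; apply/idP/idP => /andP[h1 h2]; apply/andP; split; nra.
Qed.

(** The ordinate as a function of the abscissa. *)
Definition height x := C / S ^+ 2 * (C - Num.sqrt (1 + (S * (x - 1)) ^+ 2)).

(** [S (X - 1)] is [sinh] of the angle whose [cosh] occurs in [Y_cosh]. *)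
Lemma Y_height t : Y lambda t = height (X lambda t).
Proof.
rewrite Y_cosh /height (cosh_sqrt (r * _)).
rewrite (_ : S * (X lambda t - 1) = sinh (r * (1 - 2 * t)))//.
by rewrite /X; field; rewrite gt_eqF// sinh_rl_gt0.
Qed.

Lemma HlP x y : Hl lambda (x, y) <-> x \in `[0, 2] /\ y = height x.
Proof.
split=> [[t /= tI [<- <-]]|[xI ->]]; first by rewrite X_itv Y_height.
have [t xt] : exists t, X lambda t = x.
  by eexists; apply/X_arcsinh.
by exists t; rewrite /= -?X_itv xt// Y_height xt.
Qed.

(** The half-angle formula for [cosh (r + u)], with
    [u = arcsinh (S (x - 1))]. *)
Lemma heightE x : height x =
  x - 2 * (sinh (r / 2 + 2^-1 * arcsinh (S * (x - 1))) ^+ 2 / S ^+ 2).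
Proof.
have S0 := sinh_rl_gt0; rewrite /height -[S * (x - 1)]arcsinhK -cosh_sqrt sinhK.
have : S * (x - 1) = sinh (arcsinh (S * (x - 1))) by rewrite arcsinhK.
move: (arcsinh _) => u Su.
have -> : x = 1 + sinh u / S by rewrite -Su; field; rewrite gt_eqF.
have -> : r / 2 + 2^-1 * u = (r + u) / 2 by field.
have : cosh (r + u) = 1 + 2 * sinh ((r + u) / 2) ^+ 2.
  by rewrite -cosh2x; congr cosh; field.
rewrite coshD => e; have CS := cosh2_sinh2 r.
have {}e : sinh ((r + u) / 2) ^+ 2 = (C * cosh u + S * sinh u - 1) / 2.
  by rewrite e; field.
by rewrite e; field: CS; rewrite gt_eqF.
Qed.

(** Expanding the equation of [hyperbola_eq], the constant terms cancel: the
    conic passes through the endpoint (0, 0) of the curve. *)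
Lemma hyperbola_conic :
  is_hyperbola [set p : R * R |
    tanh r ^+ 2 * p.2 ^+ 2 + 2 * p.1 = p.1 ^+ 2 + 2 * p.2].
Proof.
have S0 := sinh_rl_gt0; have C0 := cosh_gt0 r; have CS := cosh2_sinh2 r.
exists (-1), 0, (tanh r ^+ 2), 2, (-2), 0; split.
- rewrite (_ : _ - _ = 4 * tanh r ^+ 2); last by ring.
  by rewrite mulr_gt0// exprn_gt0// divr_gt0.
- rewrite (_ : _ - _ = 4 / C ^+ 2); last first.
    by rewrite /tanh; field: CS; rewrite gt_eqF.
  by rewrite gt_eqF// divr_gt0// exprn_gt0.
- by apply/seteqP; split=> p /= e; lra.
Qed.

Local Notation u t := (r * (1 - 2 * t)).
Definition X' t := - 2 * r / S * cosh (u t).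
Definition X'' t := 4 * r ^+ 2 / S * sinh (u t).
Definition Y' t := 2 * r * C / S ^+ 2 * sinh (u t).
Definition Y'' t := - 4 * r ^+ 2 * C / S ^+ 2 * cosh (u t).

Let du (t : R) : is_derive t 1 (fun t => u t) (- 2 * r).
Proof. by apply: is_derive_eq; rewrite /GRing.scale/=; ring. Qed.

Let dsinhu (t : R) :
  is_derive t 1 (fun t => sinh (u t)) (cosh (u t) * (- 2 * r)).
Proof. exact: is_derive1_comp. Qed.

Let dcoshu (t : R) :
  is_derive t 1 (fun t => cosh (u t)) (sinh (u t) * (- 2 * r)).
Proof. exact: is_derive1_comp. Qed.

Lemma is_derive_X (t : R) : is_derive t 1 (X lambda) (X' t).
Proof.
have S0 := sinh_rl_gt0; rewrite /X; apply: is_derive_eq.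
by rewrite /GRing.scale/= /X'; field; rewrite gt_eqF.
Qed.

Lemma is_derive_X' (t : R) : is_derive t 1 X' (X'' t).
Proof.
have S0 := sinh_rl_gt0; rewrite /X'; apply: is_derive_eq.
by rewrite /GRing.scale/= /X''; field; rewrite gt_eqF.
Qed.

Lemma is_derive_Y (t : R) : is_derive t 1 (Y lambda) (Y' t).
Proof.
have S0 := sinh_rl_gt0.
rewrite (_ : Y lambda = fun t => C / S ^+ 2 * (C - cosh (u t))).
  apply: is_derive_eq.
  by rewrite /GRing.scale/= /Y'; field; rewrite gt_eqF.
by apply/funext => s; rewrite Y_cosh.
Qed.

Lemma is_derive_Y' (t : R) : is_derive t 1 Y' (Y'' t).
Proof.
have S0 := sinh_rl_gt0; rewrite /Y'; apply: is_derive_eq.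
by rewrite /GRing.scale/= /Y''; field; rewrite gt_eqF.
Qed.

(** The terms in [cosh u ^ 2] and [sinh u ^ 2] have opposite coefficients, so
    [u] disappears. *)
Lemma X_Y_wronskian t : X' t * Y'' t - X'' t * Y' t = 8 * r ^+ 3 * C / S ^+ 3.
Proof.
have S0 := sinh_rl_gt0; have cs := cosh2_sinh2 (u t).
by rewrite /X' /Y' /X'' /Y''; field: cs; rewrite gt_eqF.
Qed.

Lemma is_arc_Hl : is_arc (Hl lambda).
Proof.
exists (fun t => (X lambda t, Y lambda t)); split=> //.
- have dX := is_derive_X; have dY := is_derive_Y.
  have cX : continuous (X lambda).
    by move=> t; apply/differentiable_continuous/derivable1_diffP.
  have cY : continuous (Y lambda).
    by move=> t; apply/differentiable_continuous/derivable1_diffP.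
  by apply: continuous_subspaceT => t; exact: (cvg_pair (cX t) (cY t)).
- move=> s t _ _ [XE _].
  have ht := (X_arcsinh _ t).1 erefl; have hs := (X_arcsinh _ s).1 XE.
  exact: etrans hs (esym ht).
Qed.

Lemma affine_length_Hl :
  affine_length (X lambda) (Y lambda) 0 1 = 2 * r * C `^ 3^-1 / S.
Proof.
have r0 := rl_gt0; have S0 := sinh_rl_gt0; have C0 := cosh_gt0 r.
have reg t : 0 < X' t ^+ 2 + Y' t ^+ 2.
  apply: ltr_wpDr; first exact: sqr_ge0.
  have : 0 < 2 * r / S * cosh (u t).
    by rewrite mulr_gt0 ?cosh_gt0// divr_gt0// mulr_gt0.
  have -> : X' t = - (2 * r / S * cosh (u t)) by rewrite /X'; ring.
  by move=> ?; rewrite sqrrN exprn_gt0.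
rewrite /affine_length; under eq_Rintegral => t _.
  rewrite (affine_integrandE is_derive_X is_derive_Y
                             is_derive_X' is_derive_Y' reg).
  rewrite X_Y_wronskian.
  over.
rewrite Rintegral_cst//= lebesgue_measure_itv/= lte01 oppr0 adde0 mulr1.
rewrite ger0_norm; last first.
  rewrite ltW// divr_gt0 ?exprn_gt0// mulr_gt0// mulr_gt0//.
  exact: exprn_gt0.
have -> : 8 * r ^+ 3 * C / S ^+ 3 = (2 * r / S) ^+ 3 * C.
  by field; rewrite gt_eqF.
have q0 : 0 < 2 * r / S by rewrite divr_gt0// mulr_gt0.
rewrite powRM ?exprn_ge0 ?ltW//.
rewrite -powR_mulrn ?ltW// -powRrM mulfV// powRr1 ?ltW//.
by rewrite mulrAC.
Qed.

Lemma hyperbolic_curve_Hl : hyperbolic_curve (Hl lambda).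
Proof.
split; first exact: is_arc_Hl.
apply: (ex_intro2 _ _ _ hyperbola_conic).
move=> _ [t _ <-] /=; have := hyperbola_eq t.
have T0 : tanh r ^+ 2 != 0.
  by rewrite gt_eqF// exprn_gt0// divr_gt0 ?sinh_rl_gt0 ?cosh_gt0.
move: (tanh r ^+ 2) (X _ _) (Y _ _) T0 => T x y T0 e.
have eR : (1 - T) / T = T^-1 - 1 by field.
have eL : T * (y - T^-1) ^+ 2 = T * y ^+ 2 - 2 * y + T^-1 by field.
by move: e; rewrite eR eL => e; lra.
Qed.

End HyperbolicCurve.

(** * The product over successive halvings *)

Section HalvingProduct.
Context {R : realType}.
Implicit Types r : R.

(** With [q = r / 2 ^ n.+1], the factor of index [n] is
    [(cosh (2 q) / cosh q) ^ (1/3) / cosh q], because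
    [cosh (2 q) + 1 = 2 cosh q ^ 2].  The cube roots telescope, and the
    [1 / cosh q] are absorbed by [sinh (2 q) = 2 sinh q * cosh q]. *)
Lemma prod_halvingE r n : 0 < r ->
  \prod_(0 <= k < n)
      (2 * (cosh (r / 2 ^+ k) / (2 * (cosh (r / 2 ^+ k) + 1) ^+ 2)) `^ 3^-1)
  = (cosh r / cosh (r / 2 ^+ n)) `^ 3^-1
    * (2 ^+ n * sinh (r / 2 ^+ n) / sinh r).
Proof.
move=> r0; have S0 := sinh_gt0 r0; elim: n => [|n IH].
  rewrite big_geq// expr0 divr1 !mul1r !divff ?powR1 ?mulr1// gt_eqF//.
  exact: cosh_gt0.
rewrite big_nat_recr//= IH.
have -> : r / 2 ^+ n = 2 * (r / 2 ^+ n.+1).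
  by rewrite exprS; field; rewrite expf_neq0.
set q := r / 2 ^+ n.+1.
have c0 := cosh_gt0 q; have d0 := cosh_gt0 (2 * q); have C0 := cosh_gt0 r.
have c2 : cosh (2 * q) + 1 = 2 * cosh q ^+ 2.
  by rewrite cosh2x cosh2_sinh2; ring.
rewrite c2 (_ : cosh (2 * q) / _ =
  cosh (2 * q) / cosh q * (2 * cosh q)^-1 ^+ 3); last first.
  by field; rewrite gt_eqF.
have i0 : 0 < (2 * cosh q)^-1 by rewrite invr_gt0 mulr_gt0.
have -> : (cosh (2 * q) / cosh q * (2 * cosh q)^-1 ^+ 3) `^ 3^-1 =
    (cosh (2 * q) / cosh q) `^ 3^-1 * (2 * cosh q)^-1.
  rewrite powRM ?divr_ge0 ?exprn_ge0 ?(ltW i0) ?(ltW c0) ?(ltW d0)//.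
  rewrite -[in LHS](powR_mulrn 3) ?(ltW i0)// -powRrM mulfV//.
  by rewrite powRr1 ?(ltW i0).
have -> : (cosh r / cosh q) `^ 3^-1 =
    (cosh r / cosh (2 * q)) `^ 3^-1 * (cosh (2 * q) / cosh q) `^ 3^-1.
  rewrite -powRM ?divr_ge0 ?(ltW c0) ?(ltW d0) ?(ltW C0)//.
  by congr (_ `^ _); field; rewrite !gt_eqF.
by rewrite sinh2x exprS; field; rewrite !gt_eqF.
Qed.

Lemma cvg_prod_halving r : 0 < r ->
  (fun n => \prod_(0 <= k < n)
      (2 * (cosh (r / 2 ^+ k) / (2 * (cosh (r / 2 ^+ k) + 1) ^+ 2)) `^ 3^-1))
   @ \oo --> cosh r `^ 3^-1 * (r / sinh r).
Proof.
move=> r0; have S0 := sinh_gt0 r0.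
have q0 : r / 2 ^+ n @[n --> \oo] --> 0.
  rewrite (_ : (fun n => _) = geometric r 2^-1).
    by apply: cvg_geometric; rewrite ger0_norm ?invf_lt1 ?ltr1n// invr_ge0.
  by apply/funext => n /=; rewrite exprVn.
(* [g] is the slope [z |-> sinh z / z], continuously extended at 0. *)
have /is_derive1_caratheodory [g [gE gc g0]] := is_derive_sinh (0 : R).
under eq_fun => n do rewrite prod_halvingE//.
have gq n : 2 ^+ n * sinh (r / 2 ^+ n) = g (r / 2 ^+ n) * r.
  have := gE (r / 2 ^+ n); rewrite sinh0 !subr0 => ->.
  by field; rewrite expf_neq0.
under eq_fun => n do rewrite gq.
have cosh0 : cosh 0 = 1 :> R by rewrite /cosh oppr0 expR0; field.
have -> : cosh r `^ 3^-1 * (r / sinh r)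
    = (cosh r / cosh 0) `^ 3^-1 * (g 0 * r / sinh r).
  by rewrite g0 cosh0 divr1 mul1r.
pose F x := (cosh r / cosh x) `^ 3^-1.
have cF : {for 0, continuous F}.
  have c0 := cosh_gt0 (0 : R); have cn0 : cosh (0 : R) != 0 by rewrite gt_eqF.
  have dp := is_derive1_powR 3^-1 (divr_gt0 (cosh_gt0 r) c0).
  have dV := is_deriveV cn0 (is_derive_cosh 0).
  have dF := @is_derive1_comp R (fun y => y `^ 3^-1)
    (fun x => cosh r / cosh x) 0 _ _ dp _.
  apply/differentiable_continuous/derivable1_diffP.
  by apply: ex_derive; exact: dF.
apply: cvgM; first exact: (cvg_comp _ _ q0 cF).
by apply: cvgMr_tmp; apply: cvgMr_tmp; exact: (cvg_comp _ _ q0 gc).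
Qed.

End HalvingProduct.

(** * Convex hull of the graph of a concave function *)

Section Hull.
Context {R : realType}.

(** [sqrt (1 + v ^ 2)] is the norm of (1, v); the triangle inequality reduces
    to [1 + a b <= s t], the Cauchy-Schwarz inequality for (1, a) and (1, b). *)
Lemma sqrt1_convex (a b k : R) : 0 <= k -> k <= 1 ->
  Num.sqrt (1 + (k * a + (1 - k) * b) ^+ 2)
  <= k * Num.sqrt (1 + a ^+ 2) + (1 - k) * Num.sqrt (1 + b ^+ 2).
Proof.
move=> k0 k1.
have p (v : R) : 0 <= 1 + v ^+ 2 by nra.
have := sqr_sqrtr (p a); have := sqr_sqrtr (p b).
have := sqrtr_ge0 (1 + a ^+ 2); have := sqrtr_ge0 (1 + b ^+ 2).
move: (Num.sqrt (1 + a ^+ 2)) (Num.sqrt (1 + b ^+ 2)) => s t t0 s0 t2 s2.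
have st : 1 + a * b <= s * t.
  have : (1 + a * b) ^+ 2 <= (s * t) ^+ 2.
    rewrite exprMn s2 t2 -subr_ge0.
    by rewrite (_ : _ - _ = (a - b) ^+ 2) ?sqr_ge0//; ring.
  have st0 : 0 <= s * t by rewrite mulr_ge0.
  move=> h; have [ab0|ab0] := ltP (1 + a * b) 0.
    exact: ltW (lt_le_trans ab0 st0).
  by rewrite -(ler_sqr _ _) ?nnegrE.
have rhs0 : 0 <= k * s + (1 - k) * t by rewrite addr_ge0 ?mulr_ge0//; lra.
rewrite -(ler_sqr _ _) ?nnegrE ?sqrtr_ge0//.
rewrite sqr_sqrtr//.
have -> : (k * s + (1 - k) * t) ^+ 2 =
  k ^+ 2 * s ^+ 2 + (1 - k) ^+ 2 * t ^+ 2 + 2 * (k * (1 - k)) * (s * t) by ring.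
have kk : 0 <= k * (1 - k) by rewrite mulr_ge0//; lra.
have := ler_wpM2l kk st.
by rewrite s2 t2; lra.
Qed.

(** The vertical sections of the region are the segments [0, h x]. *)
Lemma area_subgraph (a b : R) (h : R -> R) :
  (forall x, x \in `[a, b] -> 0 <= h x) ->
  area [set p | p.1 \in `[a, b] /\ 0 <= p.2 <= h p.1]
  = (\int[lebesgue_measure]_(x in `[a, b]) (h x)%:E)%E.
Proof.
move=> h0; rewrite /area /product_measure1 [RHS]integral_mkcond.
apply: eq_integral => x _; rewrite /= patchE.
case: ifPn => xab.
  have {}xab : x \in `[a, b] by rewrite inE in xab.
  rewrite (_ : xsection _ x = `[0, h x]%classic).
    rewrite lebesgue_measure_itv/= lte_fin sube0.
    (* If [h x = 0], the section is a point, of measure [0 = h x]. *)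
    by case: ltP => // hx; congr EFin; apply/eqP; rewrite eq_le hx h0.
  apply/seteqP; split=> y; rewrite /xsection/= inE/=; first by case.
  by move=> yI; split.
rewrite (_ : xsection _ x = set0) ?measure0//.
apply/seteqP; split=> y //; rewrite /xsection/= inE /= => -[xab' _].
by move/negP: xab; apply; rewrite inE.
Qed.

Section ConcaveHull.
Context (a b : R) (h : R -> R) (ab : a < b).
Context (h_concave : forall k x y, 0 <= k -> k <= 1 ->
  k * h x + (1 - k) * h y <= h (k * x + (1 - k) * y)).
Context (ha : h a = 0) (hb : h b = 0).

Let chord x : x \in `[a, b] ->
  exists k, [/\ 0 <= k, k <= 1 & x = k * a + (1 - k) * b].
Proof.
rewrite in_itv/= => /andP[ax xb]; have ba : 0 < b - a by rewrite subr_gt0.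
exists ((b - x) / (b - a)); split; first by rewrite divr_ge0//; lra.
  by rewrite ler_pdivrMr// mul1r; lra.
by field; rewrite gt_eqF.
Qed.

Lemma concave_ge0 x : x \in `[a, b] -> 0 <= h x.
Proof.
move=> /chord[k [k0 k1 ->]]; apply: le_trans (h_concave a b k0 k1).
by rewrite ha hb !mulr0 addr0.
Qed.

Let K := [set p : R * R | p.1 \in `[a, b] /\ 0 <= p.2 <= h p.1].

Lemma convex_subgraph : convex_set (K : set (R^o * R^o)%type).
Proof.
move=> p q k; rewrite !inE => -[/= pI /andP[p0 ph]] [/= qI /andP[q0 qh]].
have k0 : 0 <= k%:num by [].
have k1 : k%:num <= 1 by [].
have l0 : 0 <= 1 - k%:num by lra.
rewrite -[_ _]/(K (k%:num * p.1 + (1 - k%:num) * q.1,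
                   k%:num * p.2 + (1 - k%:num) * q.2)).
split => /=.
  move: pI qI; rewrite !in_itv/= => /andP[ap pb] /andP[aq qb].
  apply/andP; split.
    by have := ler_wpM2l k0 ap; have := ler_wpM2l l0 aq; lra.
  by have := ler_wpM2l k0 pb; have := ler_wpM2l l0 qb; lra.
apply/andP; split; first by rewrite addr_ge0// mulr_ge0.
apply: le_trans (h_concave _ _ k0 k1).
by apply: lerD; apply: ler_wpM2l.
Qed.

(** A convex set that contains the graph contains the chord joining the two
    endpoints, which is the segment [a, b] of the axis, hence every vertical
    segment from the axis to the graph. *)
Lemma convex_hull_graph (G : set (R * R)) :
  (forall x y, G (x, y) <-> x \in `[a, b] /\ y = h x) -> convex_hull G = K.
Proof.
move=> GE; apply/seteqP; split.
  move=> p; apply; split=> [|[x y] /GE[xI ->]]; first exact: convex_subgraph.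
  by split=> //=; rewrite concave_ge0/=.
move=> [x y] /= [xI /andP[y0 yh]] M [cM GM].
have MG z : z \in `[a, b] -> M (z, h z) by move=> zI; apply/GM/GE.
have conv01 (p q : R * R) k : 0 <= k -> k <= 1 -> M p -> M q ->
    M (k * p.1 + (1 - k) * q.1, k * p.2 + (1 - k) * q.2).
  move=> k0 k1 Mp Mq.
  by have := cM p q (Itv01 k0 k1); rewrite !inE => /(_ Mp Mq).
have Mx0 : M (x, 0).
  have [k [k0 k1 xE]] := chord xI.
  have Ma : M (a, h a) by apply: MG; rewrite in_itv/= lexx ltW.
  have Mb : M (b, h b) by apply: MG; rewrite in_itv/= lexx ltW.
  by have := conv01 _ _ _ k0 k1 Ma Mb; rewrite /= ha hb !mulr0 addr0 -xE.
have [hx0|hx0] := eqVneq (h x) 0.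
  have -> : y = 0 by apply/le_anti; rewrite y0 -hx0 yh.
  by [].
have {}hx0 : 0 < h x by rewrite lt_neqAle eq_sym hx0 concave_ge0.
have k0 : 0 <= y / h x by rewrite divr_ge0// ltW.
have k1 : y / h x <= 1 by rewrite ler_pdivrMr// mul1r.
have := conv01 _ _ _ k0 k1 (MG _ xI) Mx0.
by rewrite /= mulr0 addr0 -mulrDl subrKC mul1r divfK// gt_eqF.
Qed.

Lemma area_convex_hull_graph (G : set (R * R)) :
  (forall x y, G (x, y) <-> x \in `[a, b] /\ y = h x) ->
  area (convex_hull G) = (\int[lebesgue_measure]_(x in `[a, b]) (h x)%:E)%E.
Proof.
by move=> /convex_hull_graph ->; rewrite area_subgraph//; exact: concave_ge0.
Qed.

End ConcaveHull.

End Hull.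

(** * Area enclosed by the curve *)

Section Area.
Context {R : realType}.

Lemma FTC2_derivable (f F : R -> R) (a b : R) : a < b ->
  continuous f -> (forall x : R, is_derive x 1 F (f x)) ->
  (\int[lebesgue_measure]_(x in `[a, b]) (f x)%:E = (F b - F a)%:E)%E.
Proof.
move=> ab cf dF.
have cF : continuous F.
  by move=> x; apply/differentiable_continuous/derivable1_diffP.
rewrite (continuous_FTC2 (F := F) ab) ?EFinB//.
- exact: continuous_subspaceT.
- split=> [x _//||]; first exact/cvg_at_right_filter/cF.
  exact/cvg_at_left_filter/cF.
- by move=> x _; rewrite derive1E derive_val.
Qed.

Context (lambda : R) (lambda_gt0 : 0 < lambda).
Local Notation r := (rl lambda).
Local Notation C := (cosh (rl lambda)).
Local Notation S := (sinh (rl lambda)).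

Lemma height_concave k x y : 0 <= k -> k <= 1 ->
  k * height lambda x + (1 - k) * height lambda y
  <= height lambda (k * x + (1 - k) * y).
Proof.
move=> k0 k1; rewrite /height.
have cs : 0 <= C / S ^+ 2.
  by rewrite divr_ge0 ?exprn_ge0// ltW ?cosh_gt0 ?sinh_gt0 ?rl_gt0.
have := ler_wpM2l cs (sqrt1_convex (S * (x - 1)) (S * (y - 1)) k0 k1).
have -> : k * (S * (x - 1)) + (1 - k) * (S * (y - 1)) =
  S * (k * x + (1 - k) * y - 1) by ring.
by lra.
Qed.

Lemma height0 : height lambda 0 = 0.
Proof.
by rewrite /height sub0r mulrN1 sqrrN -cosh_sqrt subrr mulr0.
Qed.

Lemma height2 : height lambda 2 = 0.
Proof.
rewrite /height (_ : 2 - 1 = 1); last by ring.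
by rewrite mulr1 -cosh_sqrt subrr mulr0.
Qed.

(** The primitive comes from the substitution [v = S (x - 1)], for which
    [is_derive_primitive_sqrt] applies. *)
Lemma integral_height :
  (\int[lebesgue_measure]_(x in `[0%R, 2%R]) (height lambda x)%:E
   = (C / S ^+ 3 * (S * C - r))%:E)%E.
Proof.
have S0 := sinh_rl_gt0 lambda_gt0.
pose Q (v : R) := (v * Num.sqrt (1 + v ^+ 2) + arcsinh v) / 2.
pose F (x : R) := C / S ^+ 2 * (C * x - Q (S * (x - 1)) / S).
have dF (x : R) : is_derive x 1 F (height lambda x).
  have dv : is_derive x 1 (fun x => S * (x - 1)) S.
    by apply: is_derive_eq; rewrite /GRing.scale/=; ring.
  have dQ := @is_derive1_comp R Q (fun x => S * (x - 1)) x _ _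
    (is_derive_primitive_sqrt _) dv.
  have {}dQ : is_derive x 1 (fun x => Q (S * (x - 1))) _ := dQ.
  rewrite /F; apply: is_derive_eq.
  by rewrite /GRing.scale/= /height; field; rewrite gt_eqF.
have ch : continuous (height lambda).
  pose q (x : R) : R := 1 + (S * (x - 1)) ^+ 2.
  have cq : continuous q.
    by move=> x; apply/differentiable_continuous/derivable1_diffP.
  move=> x; rewrite /height; apply: cvgMl_tmp.
  apply: cvgB; first exact: cvg_cst.
  exact: (cvg_comp _ _ (cq x) (@sqrt_continuous R _)).
rewrite (FTC2_derivable _ ch dF)//; congr EFin.
have QN v : Q (- v) = - Q v.
  by rewrite /Q sqrrN arcsinhN; field.
have QS : Q S = (S * C + r) / 2 by rewrite /Q -cosh_sqrt sinhK.
rewrite /F sub0r mulrN1 (_ : 2 - 1 = 1) ?mulr1; last by ring.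
by rewrite QN QS; field; rewrite gt_eqF.
Qed.

Lemma area_Hl : area (convex_hull (Hl lambda)) = (C / S ^+ 3 * (S * C - r))%:E.
Proof.
rewrite -integral_height.
apply: (area_convex_hull_graph _ height_concave height0 height2) => //.
exact: HlP.
Qed.

End Area.

(** * The theorem *)

Theorem theorem1p6 (R : realType) (lambda : R) (hlambda : 0 < lambda) :
  let r := rl lambda in
  let L := affine_length (X lambda) (Y lambda) 0 1 in
  let P := fun n : nat =>
    \prod_(0 <= k < n)
      (2 * (cosh (r / 2 ^+ k) / (2 * (cosh (r / 2 ^+ k) + 1) ^+ 2)) `^ 3^-1) in
  hyperbolic_curve (Hl lambda)
  /\ (forall t : R, t \in `[0, 1] ->
        tanh r ^+ 2 * (Y lambda t - tanh r ^- 2) ^+ 2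
        = (1 - tanh r ^+ 2) / tanh r ^+ 2 + (X lambda t - 1) ^+ 2)
  /\ (forall x : R, x \in `[0, 2] ->
        forall t : R,
          t \in `[0, 1] /\ X lambda t = x
          <-> t = (r - arcsinh (sinh r * x - sinh r)) / (2 * r))
  /\ (forall x : R, x \in `[0, 2] ->
        forall y : R,
          Hl lambda (x, y)
          <-> y = x - 2 * (sinh (r / 2 + 2^-1 * arcsinh (sinh r * (x - 1))) ^+ 2
                           / sinh r ^+ 2))
  /\ [/\ area (convex_hull (Hl lambda))
         = (r * (cosh r / sinh r ^+ 3) * (sinh (2 * r) / (2 * r) - 1))%:E,
         area (convex_hull (Hl lambda))
         = (r * lambda * (cosh r / sinh r ^+ 3))%:E
       & area (convex_hull (Hl lambda))
         = (lambda / (lambda + 1) ^+ 3 * (cosh r ^+ 4 / r ^+ 2))%:E]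
  /\ [/\ cvgn P,
         L = 2 * limn P,
         L = 2 * r * cosh r `^ 3^-1 / sinh r
       & L = 2 * cosh r `^ (4 / 3) / (lambda + 1)]
  /\ (forall t : R, t \in `[0, 1] ->
        derive1 (derive1 (Y lambda)) t * derive1 (X lambda) t
        - derive1 (derive1 (X lambda)) t * derive1 (Y lambda) t = L ^+ 3).
Proof.
move=> r L P.
have r0 : 0 < r by exact: rl_gt0.
have S0 : 0 < sinh r by exact: sinh_gt0.
have C0 : 0 < cosh r by exact: cosh_gt0.
(* A relation modulo which [field] can compute: substituting a formula for
   [lambda] would also rewrite it inside [r]. *)
have lE : r * lambda = sinh r * cosh r - r.
  by rewrite -[lambda](addrK 1) lambdaD1// -/r; field; rewrite gt_eqF.
have LE : L = 2 * r * cosh r `^ 3^-1 / sinh r by exact: affine_length_Hl.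
have cvgP : P @ \oo --> cosh r `^ 3^-1 * (r / sinh r).
  exact: cvg_prod_halving.
split; first exact: hyperbolic_curve_Hl.
split; first by move=> t _; exact: hyperbola_eq.
split.
  move=> x xI t; rewrite -(X_arcsinh hlambda); split=> [[]//|xE].
  by rewrite -(X_itv hlambda) xE.
split.
  move=> x xI y; rewrite -(heightE hlambda); split=> [/(HlP hlambda)[]//|->].
  exact/(HlP hlambda).
split.
  rewrite area_Hl// -/r; split; congr EFin.
  - by rewrite sinh2x; field; rewrite !gt_eqF.
  - by field: lE; rewrite !gt_eqF.
  - by rewrite lambdaD1// -/r; field: lE; rewrite !gt_eqF.
split.
  split.
  - by apply/cvg_ex; eexists; exact: cvgP.
  - by rewrite LE (cvg_lim _ cvgP)//; field; rewrite gt_eqF.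
  - exact: LE.
  - rewrite LE lambdaD1// -/r (_ : 4 / 3 = 1 + 3^-1 :> R); last by field.
    rewrite powRD ?gt_eqF ?implybT// powRr1 ?ltW//.
    by field; rewrite !gt_eqF.
move=> t _; have dX := is_derive_X hlambda; have dY := is_derive_Y hlambda.
rewrite (derive1_is_derive dX) (derive1_is_derive dY).
rewrite (derive1_is_derive (is_derive_X' hlambda)).
rewrite (derive1_is_derive (is_derive_Y' hlambda)).
rewrite mulrC X_Y_wronskian// LE -/r.
have {1}-> : cosh r = (cosh r `^ 3^-1) ^+ 3.
  by rewrite -powR_mulrn ?powR_ge0// -powRrM mulVf// powRr1// ltW.
by field; rewrite gt_eqF.
Qed.
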